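(* For integers $p\ge1$ and $q\ge2$, $$(1-(-1)^{p+q})R_{p,q}=(-1)^p\sum_{j=0}^p (1+(-1)^j)\binom{p+q-j-1}{q-1}\zeta(j)R(p+q-j)$$ $$\quad+(-1)^p\sum_{k=0}^{q-1} (1-(-1)^k)\binom{p+q-k-2}{p-1}R(k+1)R(p+q-k-1)-(-1)^p(1+(-1)^q)\zeta(p)R(q),$$ $$(1-(-1)^{p+q})R_{\bar p,q}=-(-1)^p\sum_{j=0}^p (1+(-1)^j)\binom{p+q-j-1}{q-1}\zeta(\bar j)R(p+q-j)$$ $$\quad-(-1)^p\sum_{k=0}^{q-1} (1+(-1)^k)\binom{p+q-k-2}{p-1}R(\overline{k+1})R(\overline{p+q-k-1})+(-1)^p(1+(-1)^q)\zeta(\bar p)R(q),$$ $$(1+(-1)^{p+q})R_{\bar p,\bar q}=(-1)^p\sum_{j=0}^p (1+(-1)^j)\binom{p+q-j-1}{q-1}\zeta(j)R(\overline{p+q-j})$$ $$\quad+(-1)^p\sum_{k=0}^{q-1} (1-(-1)^k)\binom{p+q-k-2}{p-1}R(k+1)R(\overline{p+q-k-1})-(-1)^p(1-(-1)^q)\zeta(\bar p)R(\bar q),$$ $$(1+(-1)^{p+q})R_{p,\bar q}=-(-1)^p\sum_{j=0}^p (1+(-1)^j)\binom{p+q-j-1}{q-1}\zeta(\bar j)R(\overline{p+q-j})$$ $$\quad-(-1)^p\sum_{k=0}^{q-1} (1+(-1)^k)\binom{p+q-k-2}{p-1}R(\overline{k+1})R(p+q-k-1)+(-1)^p(1-(-1)^q)\zeta(p)R(\bar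 q).$$
   Context: $H_n^{(p)}=\sum_{k=1}^n k^{-p}$ and $\bar H_n^{(p)}=\sum_{k=1}^n(-1)^{k-1}k^{-p}$ (both $0$ for $n=0$). The linear (alternating) Euler $R$-sums are $$R_{p,q}=\sum_{n=0}^\infty\frac{H_n^{(p)}}{(n+1/2)^q},\quad R_{\bar p,q}=\sum_{n=0}^\infty\frac{\bar H_n^{(p)}}{(n+1/2)^q},\quad R_{p,\bar q}=\sum_{n=0}^\infty\frac{H_n^{(p)}(-1)^n}{(n+1/2)^q},\quad R_{\bar p,\bar q}=\sum_{n=0}^\infty\frac{\bar H_n^{(p)}(-1)^n}{(n+1/2)^q}.$$ The single $R$-values are $R(k)=2^k\sum_{n\ge1}\frac{1}{(2n-1)^k}$ for $k\ge2$, $R(1):=2\log 2$, and $R(\bar k)=2^k\sum_{n\ge1}\frac{(-1)^n}{(2n-1)^k}$ for $k\ge1$. The zeta values are $\zeta(k)=\sum_{n\ge1}n^{-k}$ for $k\ge2$, $\zeta(\bar k)=\sum_{n\ge1}(-1)^n n^{-k}$ for $k\ge1$, with the conventions $\zeta(0)=\zeta(\bar 0):=-1/2$ and $\zeta(1):=0$. *)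

(* Defs.v *)
From Stdlib Require Export Reals.
From Coquelicot Require Export Coquelicot.
Open Scope R_scope.

(* Coquelicot's complex field shadows the binomial coefficient [C] of the Stdlib. *)
Notation binom := Binomial.C.

(* A letter [b] encodes a bar: over p in [Rsum_b_], over q in [Rsum__b], over
   both in [Rsum_bb], and over the only bar-able argument elsewhere. *)

(* [sum_n_m a 1 0] is the empty sum, so both harmonic numbers vanish at n = 0. *)
Definition H (p n : nat) : R := sum_n_m (fun k => / INR k ^ p) 1 n.
Definition Hb (p n : nat) : R := sum_n_m (fun k => (-1) ^ (k - 1) / INR k ^ p) 1 n.

Definition Rsum (p q : nat) : R :=
  Series (fun n => H p n / (INR n + 1 / 2) ^ q).
Definition Rsum_b_ (p q : nat) : R :=
  Series (fun n => Hb p n / (INR n + 1 / 2) ^ q).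
Definition Rsum__b (p q : nat) : R :=
  Series (fun n => H p n * (-1) ^ n / (INR n + 1 / 2) ^ q).
Definition Rsum_bb (p q : nat) : R :=
  Series (fun n => Hb p n * (-1) ^ n / (INR n + 1 / 2) ^ q).

(* [Series] starts at index 0: the series below, which start at n = 1, are
   written with [S n] in place of n.  [Rval] and [Rvalb] are meant for k >= 1
   only. *)
Definition Rval (k : nat) : R :=
  match k with
  | 1%nat => 2 * ln 2
  | _ => 2 ^ k * Series (fun n => / (2 * INR (S n) - 1) ^ k)
  end.
Definition Rvalb (k : nat) : R :=
  2 ^ k * Series (fun n => (-1) ^ S n / (2 * INR (S n) - 1) ^ k).

Definition zeta (k : nat) : R :=
  match k with
  | 0%nat => - (1 / 2)
  | 1%nat => 0
  | _ => Series (fun n => / INR (S n) ^ k)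
  end.
Definition zetab (k : nat) : R :=
  match k with
  | 0%nat => - (1 / 2)
  | _ => Series (fun n => (-1) ^ S n / INR (S n) ^ k)
  end.

(* Main.v *)
Require Import Defs.
From Stdlib Require Import Reals Lra Lia.
From Coquelicot Require Import Coquelicot.
Open Scope R_scope.

(** The four identities are one identity, read at four pairs of signs e, d = 1
    or -1.  It comes from summing, over all half-integers a = m + 1/2 > 0 and all
    integers k <> 0, the quantity

      d^m e^k / (k^p (k + a)^q)

    in two ways.

    For fixed m (a row), expand in partial fractions in k.  The sums over k of
    e^k / k^i and of e^k / (k + a)^j, taken symmetrically, are
    (1 + (-1)^i) zeta(i) and e^m (1 + e (-1)^j) R(j) in their signed versions, and
    the excluded k = 0 costs a multiple of a^-(p+q).  Summing over m turns the
    remaining powers of a into R-values: this is the right-hand side, the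
    excluded terms giving the summand with zeta(0) = -1/2.

    For fixed b = k + a (a column), the sum over the remaining variable is a
    harmonic sum of sign e d, and pairing b with -b gives
    (1 - d (-1)^(p+q)) times the Euler sum, plus (-1)^p (1 + d (-1)^q) zeta(p) R(q).

    The sums are not absolutely convergent when p = 1, and when p = 1 and e d = 1
    they diverge.  They are therefore cut at m < M.  The rows are single
    convergent series ([row_cv]), the exchange of the two sums is finite
    ([rows_cols]), and the columns converge as M grows by dominated convergence
    ([tannery], [rows_lim]) once a multiple of the M-th harmonic sum is
    subtracted.  The rows contain the divergent sum of the e d-signed 1/(m + 1/2)
    with the same coefficient when e d = 1, and the difference of the two
    sequences tends to 2 log 2 ([regularised_lim]): this is what the conventions
    R(1) = 2 log 2 and zeta(1) = 0 record. *)

(** * Finite sums *)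

(** Sums over [i < n], so that empty ranges need no special case. *)
Fixpoint psum (f : nat -> R) (n : nat) : R :=
  match n with O => 0 | S m => psum f m + f m end.

Lemma psum_ext f g n :
  (forall i, (i < n)%nat -> f i = g i) -> psum f n = psum g n.
Proof.
  induction n as [|n IH]; intros E; simpl; [reflexivity|].
  rewrite IH, E; auto.
Qed.

Lemma psum_plus f g n : psum (fun i => f i + g i) n = psum f n + psum g n.
Proof. induction n as [|n IH]; simpl; [ring|rewrite IH; ring]. Qed.

Lemma psum_scal c f n : psum (fun i => c * f i) n = c * psum f n.
Proof. induction n as [|n IH]; simpl; [ring|rewrite IH; ring]. Qed.

Lemma psum_zero n : psum (fun _ => 0) n = 0.
Proof. induction n as [|n IH]; simpl; [ring|rewrite IH; ring]. Qed.

Lemma psum_exchange (f : nat -> nat -> R) m n :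
  psum (fun i => psum (f i) n) m = psum (fun j => psum (fun i => f i j) m) n.
Proof.
  induction m as [|m IH]; simpl; [now rewrite psum_zero|].
  now rewrite IH, psum_plus.
Qed.

Lemma psum_app f m n :
  psum f (m + n) = psum f m + psum (fun i => f (m + i)%nat) n.
Proof.
  induction n as [|n IH]; [rewrite Nat.add_0_r; simpl; ring|].
  rewrite Nat.add_succ_r; simpl; rewrite IH; ring.
Qed.

Lemma psum_recl f n : psum f (S n) = f O + psum (fun i => f (S i)) n.
Proof. change (S n) with (1 + n)%nat; rewrite psum_app; simpl; ring. Qed.

Lemma psum_rev f n : psum f n = psum (fun i => f (n - 1 - i)%nat) n.
Proof.
  induction n as [|n IH]; [reflexivity|].
  rewrite (psum_recl (fun i => f (S n - 1 - i)%nat)).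
  simpl psum at 1; rewrite IH, Rplus_comm.
  f_equal; [f_equal; lia|apply psum_ext; intros; f_equal; lia].
Qed.

Lemma psum_delta c m N : (m < N)%nat ->
  psum (fun n => if Nat.eq_dec n m then c else 0) N = c.
Proof.
  intros L; replace N with (m + S (N - S m))%nat by lia.
  rewrite psum_app, psum_recl.
  rewrite (psum_ext _ (fun _ => 0)), psum_zero.
  2:{ intros i Hi; destruct (Nat.eq_dec i m); [lia|reflexivity]. }
  rewrite (psum_ext _ (fun _ => 0)), psum_zero.
  2:{ intros i Hi; destruct (Nat.eq_dec _ m); [lia|reflexivity]. }
  destruct (Nat.eq_dec _ m); [ring|lia].
Qed.

Lemma psum_le f g n :
  (forall i, (i < n)%nat -> f i <= g i) -> psum f n <= psum g n.
Proof.
  induction n as [|n IH]; intros L; simpl; [lra|].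
  apply Rplus_le_compat; auto.
Qed.

Lemma psum_Rabs f n : Rabs (psum f n) <= psum (fun i => Rabs (f i)) n.
Proof.
  induction n as [|n IH]; simpl; [rewrite Rabs_R0; lra|].
  eapply Rle_trans; [apply Rabs_triang|lra].
Qed.

Lemma sum_f_R0_psum f n : sum_f_R0 f n = psum f (S n).
Proof.
  induction n as [|n IH]; [simpl; ring|].
  change (sum_f_R0 f n + f (S n) = psum f (S n) + f (S n)); now rewrite IH.
Qed.

Lemma is_lim_seq_psum (f : nat -> nat -> R) (l : nat -> R) n :
  (forall i, (i < n)%nat -> is_lim_seq (f i) (l i)) ->
  is_lim_seq (fun N => psum (fun i => f i N) n) (psum l n).
Proof.
  induction n as [|n IH]; intros L; simpl; [apply is_lim_seq_const|].
  apply is_lim_seq_plus'; auto.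
Qed.

Lemma is_series_psum (f : nat -> R) (l : R) :
  is_series f l <-> is_lim_seq (psum f) l.
Proof.
  assert (E : forall n, sum_n f n = psum f (S n)).
  { intros n; now rewrite sum_n_Reals, sum_f_R0_psum. }
  split; intros L.
  - apply is_lim_seq_incr_1, (is_lim_seq_ext (sum_n f)); [exact E|exact L].
  - change (is_lim_seq (sum_n f) l).
    apply (is_lim_seq_ext (fun n => psum f (S n))); [now intros n; rewrite E|].
    now apply is_lim_seq_incr_1 in L.
Qed.

(** * Partial fractions *)

(** [pcoef P Q a i] is the coefficient of X^-(i+1) in the principal part at X = 0
    of 1 / (X^(P+1) (X+a)^(Q+1)). *)
Definition pcoef (P Q : nat) (a : R) (i : nat) : R :=
  (-1) ^ (P - i) * binom (Q + (P - i)) Q / a ^ (S Q + (P - i)).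

(** The principal part with the powers X^-i replaced by arbitrary values: partial
    sums over X and their limits have this form. *)
Definition pcomb (P Q : nat) (a : R) (v : nat -> R) : R :=
  psum (fun i => pcoef P Q a i * v (S i)) (S P).

Definition ppart (P Q : nat) (x a : R) : R := pcomb P Q a (fun i => / x ^ i).

Lemma binom_n_0 n : binom n 0 = 1.
Proof. unfold Binomial.C; rewrite Nat.sub_0_r; simpl; field; apply INR_fact_neq_0. Qed.

Lemma binom_n_n n : binom n n = 1.
Proof. unfold Binomial.C; rewrite Nat.sub_diag; simpl; field; apply INR_fact_neq_0. Qed.

Lemma binom_pascal i j :
  binom (S i + S j) (S i) = binom (i + S j) i + binom (S i + j) (S i).
Proof.
  replace (S i + j)%nat with (i + S j)%nat by lia.
  rewrite pascal by lia; reflexivity.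
Qed.

(** The hockey-stick identity; it evaluates the correction due to the excluded
    term k = 0 of a row. *)
Lemma binom_hockey P Q :
  psum (fun j => binom (P + (Q - j)) P) (S Q) = binom (S P + Q) (S P).
Proof.
  induction Q as [|Q IH].
  - simpl psum; rewrite !Nat.add_0_r, !binom_n_n; ring.
  - rewrite psum_recl, Nat.sub_0_r, binom_pascal, <- IH; reflexivity.
Qed.

Lemma pcoef_SS P Q a i : a <> 0 -> (i <= P)%nat ->
  a * pcoef (S P) (S Q) a i = pcoef (S P) Q a i - pcoef P (S Q) a i.
Proof.
  intros Ha Hi; unfold pcoef.
  replace (S P - i)%nat with (S (P - i)) by lia.
  generalize (P - i)%nat; intros r.
  rewrite binom_pascal.
  replace (S (S Q) + S r)%nat with (S (S Q + S r)) by lia.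
  replace (S (S Q) + r)%nat with (S Q + S r)%nat by lia.
  change ((-1) ^ S r) with (-1 * (-1) ^ r).
  change (a ^ S (S Q + S r)) with (a * a ^ (S Q + S r)).
  assert (a ^ (S Q + S r) <> 0) by now apply pow_nonzero.
  field; auto.
Qed.

(** Multiplying 1 / (x^p y^q) by a = y - x lowers q or p by one; on principal
    parts this recursion is Pascal's rule. *)
Lemma ppart_SS P Q x a : a <> 0 ->
  a * ppart (S P) (S Q) x a = ppart (S P) Q x a - ppart P (S Q) x a.
Proof.
  intros Ha; unfold ppart, pcomb.
  change (psum ?f (S (S P))) with (psum f (S P) + f (S P)).
  rewrite Rmult_plus_distr_l, <- psum_scal.
  rewrite (psum_ext _ (fun i => pcoef (S P) Q a i * / x ^ S i
                       + (-1) * (pcoef P (S Q) a i * / x ^ S i))).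
  2:{ intros i Hi; rewrite <- Rmult_assoc, pcoef_SS by (auto; lia); ring. }
  rewrite psum_plus, psum_scal.
  replace (a * (pcoef (S P) (S Q) a (S P) * / x ^ S (S P)))
    with (pcoef (S P) Q a (S P) * / x ^ S (S P)); [ring|].
  unfold pcoef; rewrite !Nat.sub_diag, !Nat.add_0_r, !binom_n_n.
  change (a ^ S (S Q)) with (a * a ^ S Q).
  assert (a ^ S Q <> 0) by now apply pow_nonzero.
  generalize (/ x ^ S (S P)); intros y; field; auto.
Qed.

Lemma ppart_S0 P x a : a <> 0 ->
  a * ppart (S P) 0 x a = / x ^ S (S P) - ppart P 0 x a.
Proof.
  intros Ha; unfold ppart, pcomb.
  change (psum ?f (S (S P))) with (psum f (S P) + f (S P)).
  rewrite Rmult_plus_distr_l, <- psum_scal.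
  rewrite (psum_ext _ (fun i => (-1) * (pcoef P 0 a i * / x ^ S i))).
  2:{ intros i Hi; unfold pcoef; rewrite !binom_n_0.
      replace (S P - i)%nat with (S (P - i)) by lia.
      generalize (P - i)%nat; intros r.
      change ((-1) ^ S r) with (-1 * (-1) ^ r).
      change (a ^ (1 + S r)) with (a * a ^ (1 + r)).
      assert (a ^ (1 + r) <> 0) by now apply pow_nonzero.
      generalize (/ x ^ S i); intros y; field; auto. }
  rewrite psum_scal.
  replace (a * (pcoef (S P) 0 a (S P) * / x ^ S (S P)))
    with (/ x ^ S (S P)); [ring|].
  unfold pcoef; rewrite !Nat.sub_diag, binom_n_0.
  generalize (/ x ^ S (S P)); intros y; simpl; field; auto.
Qed.

Lemma ppart_0S Q x a : a <> 0 -> a * ppart 0 (S Q) x a = ppart 0 Q x a.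
Proof.
  intros Ha; unfold ppart, pcomb, pcoef; simpl psum.
  rewrite !Nat.add_0_r, !binom_n_n.
  change (a ^ S (S Q)) with (a * a ^ S Q).
  assert (a ^ S Q <> 0) by now apply pow_nonzero.
  generalize (/ (x * 1)); intros y.
  replace (a * a ^ Q) with (a ^ S Q) by reflexivity.
  replace (a * (a * a ^ Q)) with (a * a ^ S Q) by reflexivity.
  field; auto.
Qed.

(** Both sides obey the recursion of [ppart_SS].  The two principal parts are the
    same function because exchanging x and y changes the sign of y - x. *)
Lemma partial_fractions P Q x y : x <> 0 -> y <> 0 -> x <> y ->
  / (x ^ S P * y ^ S Q) = ppart P Q x (y - x) + ppart Q P y (x - y).
Proof.
  intros Hx Hy Hxy.
  assert (Ha : y - x <> 0) by lra.
  assert (Hb : x - y <> 0) by lra.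
  assert (Hpx : forall k, x ^ k <> 0) by (intros; now apply pow_nonzero).
  assert (Hpy : forall k, y ^ k <> 0) by (intros; now apply pow_nonzero).
  revert Q; induction P as [|P IHP]; induction Q as [|Q IHQ].
  - unfold ppart, pcomb, pcoef; simpl psum; rewrite binom_n_0; simpl; field; auto.
  - apply (Rmult_eq_reg_l (y - x)); [|exact Ha].
    rewrite Rmult_plus_distr_l, ppart_0S by exact Ha.
    replace ((y - x) * ppart (S Q) 0 y (x - y))
      with (- ((x - y) * ppart (S Q) 0 y (x - y))) by ring.
    rewrite ppart_S0 by exact Hb.
    transitivity (/ (x ^ 1 * y ^ S Q) - / y ^ S (S Q)); [|rewrite IHQ; ring].
    specialize (Hpy Q); simpl; field; auto.
  - apply (Rmult_eq_reg_l (y - x)); [|exact Ha].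
    rewrite Rmult_plus_distr_l, ppart_S0 by exact Ha.
    replace ((y - x) * ppart 0 (S P) y (x - y))
      with (- ((x - y) * ppart 0 (S P) y (x - y))) by ring.
    rewrite ppart_0S by exact Hb.
    transitivity (/ x ^ S (S P) - / (x ^ S P * y ^ 1)); [|rewrite (IHP O); ring].
    specialize (Hpx P); simpl; field; auto.
  - apply (Rmult_eq_reg_l (y - x)); [|exact Ha].
    rewrite Rmult_plus_distr_l, ppart_SS by exact Ha.
    replace ((y - x) * ppart (S Q) (S P) y (x - y))
      with (- ((x - y) * ppart (S Q) (S P) y (x - y))) by ring.
    rewrite ppart_SS by exact Hb.
    transitivity (/ (x ^ S (S P) * y ^ S Q) - / (x ^ S P * y ^ S (S Q)));
      [|rewrite IHQ, (IHP (S Q)); ring].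
    specialize (Hpx P); specialize (Hpy Q); simpl; field; auto.
Qed.

(** * Signed harmonic sums *)

(** The letter [s] stands for signed: the sign is a real [e] with [e * e = 1]. *)
Definition sharm (e : R) (p n : nat) : R :=
  psum (fun k => e ^ S k / INR (S k) ^ p) n.

Definition shalf (e : R) (q n : nat) : R :=
  psum (fun k => e ^ k / (INR k + 1 / 2) ^ q) n.

(** The sum over [m < M] that skips [m = n], by means of [/ 0 = 0].  The sign
    is [e ^ (n + m)] rather than [e ^ (n - m)], which is the same number. *)
Definition spunct (e : R) (p n M : nat) : R :=
  psum (fun m => e ^ (n + m) / (INR n - INR m) ^ p) M.

Lemma sign_pow_even e k : e * e = 1 -> e ^ (2 * k) = 1.
Proof. intros He; rewrite pow_mult; simpl; rewrite Rmult_1_r, He; apply pow1. Qed.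

Lemma sign_pow_cancel e a b c : e * e = 1 -> a = (b + 2 * c)%nat -> e ^ a = e ^ b.
Proof. intros He ->; rewrite pow_add, sign_pow_even by exact He; ring. Qed.

Lemma sign_Rabs e k : e * e = 1 -> Rabs (e ^ k) = 1.
Proof.
  intros He; assert (E : Rabs e = 1).
  { assert (H0 : (e - 1) * (e + 1) = 0) by (ring_simplify; simpl; lra).
    apply Rmult_integral in H0; destruct H0.
    - replace e with 1 by lra; apply Rabs_R1.
    - replace e with (-1) by lra; rewrite Rabs_left; lra. }
  rewrite <- RPow_abs, E; apply pow1.
Qed.

Lemma neg1_sq : (-1) * (-1) = 1. Proof. ring. Qed.

Lemma pow_opp x k : (- x) ^ k = (-1) ^ k * x ^ k.
Proof. rewrite <- Rpow_mult_distr; f_equal; ring. Qed.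

Lemma inv_pow_opp x k : / (- x) ^ k = (-1) ^ k * / x ^ k.
Proof.
  rewrite pow_opp, Rinv_mult; f_equal.
  rewrite <- pow_inv; f_equal; lra.
Qed.

Lemma sharm_add e p m n :
  sharm e p (m + n) - sharm e p m
  = psum (fun i => e ^ (m + S i) / INR (m + S i) ^ p) n.
Proof.
  unfold sharm; rewrite psum_app; ring_simplify; apply psum_ext; intros i Hi.
  now rewrite <- plus_n_Sm.
Qed.

(** The differences n - m run over r + 1, ..., r + M where n = M + r. *)
Lemma spunct_below e p r M : e * e = 1 ->
  spunct e p (M + r) M = sharm e p (M + r) - sharm e p r.
Proof.
  intros He; rewrite (Nat.add_comm M r), sharm_add; unfold spunct; rewrite psum_rev.
  apply psum_ext; intros i Hi.
  replace (INR (r + M) - INR (M - 1 - i)) with (INR (r + S i)).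
  2:{ rewrite <- minus_INR by lia; f_equal; lia. }
  rewrite (sign_pow_cancel e _ (r + S i) (M - 1 - i) He) by lia; reflexivity.
Qed.

(** The differences n - m run over n, ..., 1, 0, -1, ..., -r. *)
Lemma spunct_above e p n r : e * e = 1 -> (1 <= p)%nat ->
  spunct e p n (S n + r) = sharm e p n + (-1) ^ p * sharm e p r.
Proof.
  intros He Hp; unfold spunct; rewrite psum_app.
  change (psum ?f (S n)) with (psum f n + f n).
  change (psum (fun m : nat => e ^ (n + m) / (INR n - INR m) ^ p) n) with (spunct e p n n).
  assert (E := spunct_below e p 0 n He); rewrite Nat.add_0_r in E; rewrite E.
  unfold sharm at 2; simpl psum at 1.
  replace (INR n - INR n) with 0 by ring.
  rewrite (pow_i p) by lia; unfold Rdiv at 1; rewrite Rinv_0.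
  unfold sharm at 3; rewrite <- psum_scal.
  rewrite (psum_ext _ (fun i => (-1) ^ p * (e ^ S i / INR (S i) ^ p))); [ring|].
  intros i Hi.
  replace (INR n - INR (S n + i)) with (- INR (S i)).
  2:{ rewrite plus_INR, !S_INR; ring. }
  unfold Rdiv; rewrite inv_pow_opp.
  rewrite (sign_pow_cancel e _ (S i) n He) by lia; ring.
Qed.

Lemma sharm1_incr n m : (n <= m)%nat -> sharm 1 1 n <= sharm 1 1 m.
Proof.
  intros L; replace m with (n + (m - n))%nat by lia.
  assert (E := sharm_add 1 1 n (m - n)).
  assert (0 <= psum (fun i => 1 ^ (n + S i) / INR (n + S i) ^ 1) (m - n)); [|lra].
  rewrite <- (psum_zero (m - n)); apply psum_le; intros i _.
  rewrite pow1, pow_1; apply Rlt_le, Rdiv_lt_0_compat; [lra|apply lt_0_INR; lia].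
Qed.

(** Shifting a block of consecutive terms to the left increases it, which makes
    the bound independent of the position [r]. *)
Lemma sharm_block_bound e p r k : e * e = 1 -> (1 <= p)%nat ->
  Rabs (sharm e p (r + k) - sharm e p r) <= sharm 1 1 k.
Proof.
  intros He Hp; rewrite sharm_add.
  eapply Rle_trans; [apply psum_Rabs|]; apply psum_le; intros i _.
  unfold Rdiv; rewrite Rabs_mult, sign_Rabs, pow1, pow_1 by exact He.
  assert (H1 : 1 <= INR (S i)) by (rewrite S_INR; generalize (pos_INR i); lra).
  assert (H2 : INR (S i) <= INR (r + S i)) by (apply le_INR; lia).
  assert (H3 : INR (r + S i) <= INR (r + S i) ^ p).
  { rewrite <- (pow_1 (INR (r + S i))) at 1; apply Rle_pow; [lra|lia]. }
  rewrite Rabs_pos_eq; [|apply Rlt_le, Rinv_0_lt_compat; lra].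
  rewrite !Rmult_1_l; apply Rinv_le_contravar; lra.
Qed.

Lemma sharm_bound e p k : e * e = 1 -> (1 <= p)%nat -> Rabs (sharm e p k) <= sharm 1 1 k.
Proof.
  intros He Hp; generalize (sharm_block_bound e p 0 k He Hp).
  unfold sharm at 2; simpl; now rewrite Rminus_0_r.
Qed.

(** The bound does not depend on [M]; it is the domination needed in [tannery]. *)
Lemma spunct_bound e p n M : e * e = 1 -> (1 <= p)%nat ->
  Rabs (spunct e p n M - sharm e p n - (-1) ^ p * sharm e p M) <= 2 * sharm 1 1 (S n).
Proof.
  intros He Hp.
  assert (I := sharm1_incr n (S n) (Nat.le_succ_diag_r n)).
  destruct (Nat.le_gt_cases M n) as [L|L].
  - replace n with (M + (n - M))%nat at 1 2 by lia; rewrite spunct_below by exact He.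
    replace (sharm e p (M + (n - M)) - sharm e p (n - M) - sharm e p (M + (n - M)) -
       (-1) ^ p * sharm e p M) with (- (sharm e p (n - M) + (-1) ^ p * sharm e p M)) by ring.
    rewrite Rabs_Ropp; eapply Rle_trans; [apply Rabs_triang|].
    rewrite Rabs_mult, (sign_Rabs (-1)), Rmult_1_l by apply neg1_sq.
    assert (B1 := sharm_bound e p (n - M) He Hp).
    assert (B2 := sharm_bound e p M He Hp).
    assert (I1 := sharm1_incr (n - M) n); assert (I2 := sharm1_incr M n L).
    assert (n - M <= n)%nat by lia; specialize (I1 H); lra.
  - replace M with (S n + (M - S n))%nat at 1 by lia.
    rewrite spunct_above by auto.
    assert (B := sharm_block_bound e p (M - S n) (S n) He Hp).
    replace (M - S n + S n)%nat with M in B by lia.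
    replace (sharm e p n + (-1) ^ p * sharm e p (M - S n) - sharm e p n -
       (-1) ^ p * sharm e p M) with ((-1) ^ p * - (sharm e p M - sharm e p (M - S n))) by ring.
    rewrite Rabs_mult, (sign_Rabs (-1)), Rmult_1_l, Rabs_Ropp by apply neg1_sq.
    assert (0 <= sharm 1 1 (S n)) by (eapply Rle_trans; [apply Rabs_pos|exact B]).
    lra.
Qed.

Lemma is_lim_seq_pow (u : nat -> R) (l : R) k :
  is_lim_seq u l -> is_lim_seq (fun n => u n ^ k) (l ^ k).
Proof.
  intros L; induction k as [|k IH]; simpl; [apply is_lim_seq_const|].
  now apply is_lim_seq_mult'.
Qed.

Lemma is_lim_seq_inv_pow c k : (1 <= k)%nat ->
  is_lim_seq (fun n => / (INR n + c) ^ k) 0.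
Proof.
  intros Hk.
  apply is_lim_seq_ext with (fun n => (/ (INR n + c)) ^ k).
  { intros n; apply pow_inv. }
  replace 0 with (0 ^ k) by (apply pow_i; lia).
  apply is_lim_seq_pow.
  assert (E : Rbar_inv (Rbar_plus p_infty c) = 0) by reflexivity.
  rewrite <- E; apply is_lim_seq_inv; [|discriminate].
  apply is_lim_seq_plus with p_infty c;
    [apply is_lim_seq_INR|apply is_lim_seq_const|reflexivity].
Qed.

Lemma is_lim_seq_sign_mult e (s : nat -> nat) (u : nat -> R) :
  e * e = 1 -> is_lim_seq u 0 -> is_lim_seq (fun n => e ^ s n * u n) 0.
Proof.
  intros He L; apply is_lim_seq_abs_0.
  apply is_lim_seq_ext with (fun n => Rabs (u n)).
  { intros n; rewrite Rabs_mult, sign_Rabs by exact He; ring. }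
  now apply -> is_lim_seq_abs_0.
Qed.

(** Each of the [k] terms of the block tends to 0, even if the series diverges. *)
Lemma psum_block_lim (f : nat -> R) k : is_lim_seq f 0 ->
  is_lim_seq (fun n => psum f (n + k) - psum f n) 0.
Proof.
  intros L; induction k as [|k IH].
  - apply is_lim_seq_ext with (fun _ => 0); [|apply is_lim_seq_const].
    intros n; rewrite Nat.add_0_r; ring.
  - apply is_lim_seq_ext with (fun n => (psum f (n + k) - psum f n) + f (n + k)%nat).
    { intros n; rewrite <- plus_n_Sm; simpl; ring. }
    replace (Finite 0) with (Finite (0 + 0)) by (f_equal; ring).
    apply is_lim_seq_plus'; [exact IH|].
    now apply is_lim_seq_incr_n.
Qed.

Lemma sharm_block_lim e p k : e * e = 1 -> (1 <= p)%nat ->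
  is_lim_seq (fun n => sharm e p (n + k) - sharm e p n) 0.
Proof.
  intros He Hp; apply psum_block_lim.
  apply is_lim_seq_ext with (fun n => e ^ S n * / (INR n + 1) ^ p).
  { intros n; now rewrite S_INR. }
  apply is_lim_seq_sign_mult; [exact He|now apply is_lim_seq_inv_pow].
Qed.

Lemma spunct_lim e p n : e * e = 1 -> (1 <= p)%nat ->
  is_lim_seq (fun M => spunct e p n M - sharm e p n - (-1) ^ p * sharm e p M) 0.
Proof.
  intros He Hp; apply (is_lim_seq_incr_n _ (S n)).
  apply is_lim_seq_ext with
    (fun M => - (-1) ^ p * (sharm e p (M + S n) - sharm e p M)).
  { intros M; rewrite (Nat.add_comm M (S n)), spunct_above by auto; ring. }
  replace (Finite 0) with (Rbar_mult (- (-1) ^ p) 0) by (simpl; f_equal; ring).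
  now apply is_lim_seq_scal_l, sharm_block_lim.
Qed.

(** * Dominated convergence and summability *)

(** The tail beyond [N] is small uniformly in [M], by domination, and the first
    [N] terms tend to 0 one by one. *)
Lemma tannery (f : nat -> nat -> R) (g : nat -> R) :
  (forall M n, Rabs (f M n) <= g n) -> ex_series g ->
  (forall n, is_lim_seq (fun M => f M n) 0) ->
  is_lim_seq (fun M => Series (f M)) 0.
Proof.
  intros B Xg L.
  assert (Xf : forall M, ex_series (f M)).
  { intros M; apply (ex_series_le (K := R_AbsRing) (V := R_CompleteNormedModule)) with g;
      [intros n; apply B|exact Xg]. }
  assert (Lg := proj1 (is_series_psum g _) (Series_correct g Xg)).
  (* the tails are dominated by those of g *)
  assert (T : forall M N, Rabs (Series (f M) - psum (f M) N) <= Series g - psum g N).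
  { intros M N.
    assert (L1 : is_lim_seq (fun k => Rabs (psum (f M) (k + N) - psum (f M) N))
                   (Rabs (Series (f M) - psum (f M) N))).
    { apply (is_lim_seq_abs _ (Finite (Series (f M) - psum (f M) N))).
      apply is_lim_seq_minus'; [|apply is_lim_seq_const].
      apply (is_lim_seq_incr_n (psum (f M)) N).
      exact (proj1 (is_series_psum _ _) (Series_correct _ (Xf M))). }
    assert (L2 : is_lim_seq (fun k => psum g (k + N) - psum g N) (Series g - psum g N)).
    { apply is_lim_seq_minus'; [|apply is_lim_seq_const].
      now apply (is_lim_seq_incr_n (psum g) N). }
    refine (is_lim_seq_le _ _ _ _ _ L1 L2); intros k.
    rewrite (Nat.add_comm k N), !psum_app.
    replace (psum (f M) N + psum (fun i => f M (N + i)%nat) k - psum (f M) N)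
      with (psum (fun i => f M (N + i)%nat) k) by ring.
    replace (psum g N + psum (fun i => g (N + i)%nat) k - psum g N)
      with (psum (fun i => g (N + i)%nat) k) by ring.
    eapply Rle_trans; [apply psum_Rabs|apply psum_le; intros; apply B]. }
  apply is_lim_seq_Reals; intros eps Heps.
  apply is_lim_seq_Reals in Lg.
  destruct (Lg (eps / 2)) as [N HN]; [lra|].
  specialize (HN N (Nat.le_refl N)); unfold Rdist in HN.
  assert (L0 : is_lim_seq (fun M => psum (f M) N) 0).
  { rewrite <- (psum_zero N).
    apply (is_lim_seq_psum (fun n M => f M n) (fun _ => 0)); auto. }
  apply is_lim_seq_Reals in L0.
  destruct (L0 (eps / 2)) as [M0 HM0]; [lra|].
  exists M0; intros M HM; specialize (HM0 M HM); specialize (T M N).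
  unfold Rdist in *; rewrite Rminus_0_r in *.
  rewrite Rabs_minus_sym in HN.
  replace (Series (f M)) with ((Series (f M) - psum (f M) N) + psum (f M) N) by ring.
  eapply Rle_lt_trans; [apply Rabs_triang|].
  assert (A1 := Rle_abs (Series g - psum g N)); lra.
Qed.

Lemma ex_series_telescope (t v : nat -> R) :
  (forall n, 0 <= t n <= v n - v (S n)) -> (forall n, 0 <= v n) -> ex_series t.
Proof.
  intros B V.
  assert (S0 : forall n, psum t n <= v O - v n).
  { induction n as [|n IH]; simpl; [lra|]. specialize (B n); lra. }
  destruct (ex_finite_lim_seq_incr (psum t) (v O)) as [l Hl].
  - intros n; simpl; specialize (B n); lra.
  - intros n; specialize (S0 n); specialize (V n); lra.
  - exists l; now apply is_series_psum.
Qed.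

(** Abel summation of H_(n+1) / ((n+1)(n+2)) shows that it is at most
    v_n - v_(n+1) with v_n = (H_(n+1) + 1) / (n+1). *)
Lemma ex_series_sharm1_weight q : (2 <= q)%nat ->
  ex_series (fun n => sharm 1 1 (S n) / (INR n + 1 / 2) ^ q).
Proof.
  intros Hq.
  assert (P : forall n, 1 <= sharm 1 1 (S n)).
  { intros n; generalize (sharm1_incr 1 (S n)); unfold sharm at 1; simpl; intros I.
    specialize (I ltac:(lia)); lra. }
  (* 8 because (n+1)(n+2) <= 8 (n+1/2)^2; the power because 1/(n+1/2) <= 2 *)
  set (c := 8 * 2 ^ (q - 2)).
  assert (Hc : 0 < c) by (unfold c; generalize (pow_lt 2 (q - 2)); lra).
  apply ex_series_telescope
    with (v := fun n => c * ((sharm 1 1 (S n) + 1) / (INR n + 1))).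
  2:{ intros n; specialize (P n); generalize (pos_INR n); intros.
      apply Rmult_le_pos; [lra|]. apply Rlt_le, Rdiv_lt_0_compat; lra. }
  intros n; specialize (P n); assert (N := pos_INR n).
  assert (E : sharm 1 1 (S (S n)) = sharm 1 1 (S n) + / (INR n + 2)).
  { unfold sharm at 1; change (psum ?f (S (S n))) with (psum f (S n) + f (S n)).
    fold (sharm 1 1 (S n)); cbv beta; rewrite pow1, pow_1, !S_INR; f_equal; field; lra. }
  rewrite E, S_INR; generalize dependent (sharm 1 1 (S n)); intros h P _.
  assert (Hpow : / (INR n + 1 / 2) ^ q <= c / ((INR n + 1) * (INR n + 2))).
  { replace q with (2 + (q - 2))%nat at 1 by lia.
    rewrite pow_add, Rinv_mult, <- (pow_inv _ (q - 2)).
    assert (A1 : (/ (INR n + 1 / 2)) ^ (q - 2) <= 2 ^ (q - 2)).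
    { apply pow_incr; split; [apply Rlt_le, Rinv_0_lt_compat; lra|].
      replace 2 with (/ (1 / 2)) by field; apply Rinv_le_contravar; lra. }
    assert (A2 : / (INR n + 1 / 2) ^ 2 <= 8 / ((INR n + 1) * (INR n + 2))).
    { replace (8 / ((INR n + 1) * (INR n + 2)))
        with (/ ((INR n + 1) * (INR n + 2) / 8)) by (field; lra).
      apply Rinv_le_contravar; nra. }
    unfold c; replace (8 * 2 ^ (q - 2) / ((INR n + 1) * (INR n + 2)))
      with (8 / ((INR n + 1) * (INR n + 2)) * 2 ^ (q - 2)) by (field; lra).
    apply Rmult_le_compat; auto.
    - apply Rlt_le, Rinv_0_lt_compat, pow_lt; lra.
    - apply pow_le, Rlt_le, Rinv_0_lt_compat; lra. }
  assert (Hpos : 0 < / (INR n + 1 / 2) ^ q) by (apply Rinv_0_lt_compat, pow_lt; lra).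
  split; [unfold Rdiv; apply Rmult_le_pos; lra|].
  apply Rle_trans with (h * (c / ((INR n + 1) * (INR n + 2)))).
  { unfold Rdiv at 1; apply Rmult_le_compat_l; lra. }
  assert (D : 0 < c / ((INR n + 1) * (INR n + 2) * (INR n + 2))).
  { apply Rdiv_lt_0_compat; [lra|]; repeat apply Rmult_lt_0_compat; lra. }
  replace (c * ((h + 1) / (INR n + 1)) -
     c * ((h + / (INR n + 2) + 1) / (INR n + 1 + 1)))
    with (h * (c / ((INR n + 1) * (INR n + 2)))
          + c / ((INR n + 1) * (INR n + 2) * (INR n + 2))); [lra|].
  field; lra.
Qed.

(** * Signed zeta and R-values *)

(** [true] stands for a bar. *)
Definition sgn (b : bool) : R := if b then -1 else 1.
Definition zeta_sgn (b : bool) (k : nat) : R := if b then zetab k else zeta k.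
(** The minus sign makes this the sum of [sgn b ^ n / (n + 1/2) ^ k] over all
    [n], since [Rvalb] starts with a negative term. *)
Definition Rval_sgn (b : bool) (k : nat) : R := if b then - Rvalb k else Rval k.

Lemma sgn_sq b : sgn b * sgn b = 1.
Proof. destruct b; simpl; ring. Qed.

Lemma ex_series_inv_pow c k : 1 / 2 <= c -> (2 <= k)%nat ->
  ex_series (fun n => / (INR n + c) ^ k).
Proof.
  intros Hc Hk.
  apply (ex_series_le (K := R_AbsRing) (V := R_CompleteNormedModule)) with
    (fun n => sharm 1 1 (S n) / (INR n + 1 / 2) ^ k); [|now apply ex_series_sharm1_weight].
  intros n; assert (N := pos_INR n).
  assert (P1 : 0 < (INR n + c) ^ k) by (apply pow_lt; lra).
  assert (P2 : 0 < (INR n + 1 / 2) ^ k) by (apply pow_lt; lra).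
  assert (P3 : (INR n + 1 / 2) ^ k <= (INR n + c) ^ k) by (apply pow_incr; lra).
  apply Rle_trans with (/ (INR n + 1 / 2) ^ k).
  - change (Rabs (/ (INR n + c) ^ k) <= / (INR n + 1 / 2) ^ k).
    rewrite Rabs_pos_eq by (now apply Rlt_le, Rinv_0_lt_compat).
    now apply Rinv_le_contravar.
  - rewrite <- (Rmult_1_l (/ _)); unfold Rdiv; apply Rmult_le_compat_r.
    + now apply Rlt_le, Rinv_0_lt_compat.
    + generalize (sharm1_incr 1 (S n)); unfold sharm at 1; simpl; intros I.
      specialize (I ltac:(lia)); lra.
Qed.

Lemma ex_series_alt_inv_pow c k : 0 < c -> (1 <= k)%nat ->
  ex_series (fun n => (-1) ^ n * / (INR n + c) ^ k).
Proof.
  intros Hc Hk.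
  destruct (alternated_series (fun n => / (INR n + c) ^ k)) as [l Hl].
  - intros n; assert (N := pos_INR n); apply Rinv_le_contravar.
    + apply pow_lt; lra.
    + rewrite S_INR; apply pow_incr; lra.
  - now apply is_lim_seq_Reals, is_lim_seq_inv_pow.
  - exists l; change (is_lim_seq (sum_n (fun n => (-1) ^ n * / (INR n + c) ^ k)) l).
    apply is_lim_seq_Reals in Hl; revert Hl; apply is_lim_seq_ext.
    intros n; now rewrite sum_n_Reals.
Qed.

Lemma ex_series_sgn_inv_pow b c k : 1 / 2 <= c -> (1 <= k)%nat ->
  (b = false -> (2 <= k)%nat) -> ex_series (fun n => sgn b ^ n * / (INR n + c) ^ k).
Proof.
  intros Hc Hk Hb; destruct b; unfold sgn.
  - apply ex_series_alt_inv_pow; [lra|exact Hk].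
  - eapply ex_series_ext; [|apply (ex_series_inv_pow c k Hc); auto].
    intros n; cbv beta; rewrite pow1; symmetry; apply Rmult_1_l.
Qed.

Lemma psum_lim_Series f : ex_series f -> is_lim_seq (psum f) (Series f).
Proof. intros X; now apply is_series_psum, Series_correct. Qed.

Lemma sharm_lim b k : (1 <= k)%nat -> (b = false -> (2 <= k)%nat) ->
  is_lim_seq (sharm (sgn b) k) (zeta_sgn b k).
Proof.
  intros Hk Hb.
  assert (X : ex_series (fun n => sgn b ^ S n / INR (S n) ^ k)).
  { eapply ex_series_ext;
      [|apply (ex_series_scal (V := R_NormedModule) (sgn b)), (ex_series_sgn_inv_pow b 1 k);
        [lra|exact Hk|exact Hb]].
    intros n; cbv beta; rewrite S_INR.
    change (sgn b * (sgn b ^ n * / (INR n + 1) ^ k) = sgn b * sgn b ^ n / (INR n + 1) ^ k).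
    unfold Rdiv; ring. }
  replace (zeta_sgn b k) with (Series (fun n => sgn b ^ S n / INR (S n) ^ k));
    [exact (psum_lim_Series _ X)|].
  destruct b; unfold zeta_sgn, sgn.
  - destruct k; [lia|reflexivity].
  - destruct k as [|[|k]]; [lia|specialize (Hb eq_refl); lia|].
    apply Series_ext; intros n; rewrite pow1; unfold Rdiv; ring.
Qed.

Lemma shalf_lim b k : (1 <= k)%nat -> (b = false -> (2 <= k)%nat) ->
  is_lim_seq (shalf (sgn b) k) (Rval_sgn b k).
Proof.
  intros Hk Hb.
  assert (X := ex_series_sgn_inv_pow b (1 / 2) k (Rle_refl _) Hk Hb).
  replace (Rval_sgn b k) with (Series (fun n => sgn b ^ n * / (INR n + 1 / 2) ^ k));
    [exact (psum_lim_Series _ X)|].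
  assert (E : forall n, 2 ^ k * / (2 * INR (S n) - 1) ^ k = / (INR n + 1 / 2) ^ k).
  { intros n; assert (N := pos_INR n).
    replace (2 * INR (S n) - 1) with (2 * (INR n + 1 / 2)) by (rewrite S_INR; field).
    rewrite Rpow_mult_distr, Rinv_mult, <- Rmult_assoc, Rinv_r; [ring|].
    apply pow_nonzero; lra. }
  destruct b; unfold Rval_sgn, sgn.
  - unfold Rvalb; rewrite <- Series_scal_l, <- Series_opp.
    apply Series_ext; intros n; rewrite <- E; simpl; unfold Rdiv; ring.
  - destruct k as [|[|k]]; [lia|specialize (Hb eq_refl); lia|].
    unfold Rval; rewrite <- Series_scal_l.
    apply Series_ext; intros n; rewrite <- E, pow1; ring.
Qed.

(** The factor vanishes in the only divergent case, k = 1 without sign. *)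
Lemma sharm_even_lim b k : (1 <= k)%nat ->
  is_lim_seq (fun N => (1 + (-1) ^ k) * sharm (sgn b) k N) ((1 + (-1) ^ k) * zeta_sgn b k).
Proof.
  intros Hk.
  assert (D : (b = false -> (2 <= k)%nat) \/ k = 1%nat).
  { destruct (Nat.le_gt_cases 2 k); [left; auto|right; lia]. }
  destruct D as [D| ->].
  - apply (is_lim_seq_scal_l _ _ (Finite _)), sharm_lim; auto.
  - replace ((1 + (-1) ^ 1) * zeta_sgn b 1) with 0 by ring.
    apply is_lim_seq_ext with (fun _ => 0); [intros; ring|apply is_lim_seq_const].
Qed.

(** As in [sharm_even_lim], the factor vanishes in the only divergent case. *)
Lemma shalf_even_lim b k : (1 <= k)%nat ->
  is_lim_seq (fun N => (1 + sgn b * (-1) ^ k) * shalf (sgn b) k N)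
             ((1 + sgn b * (-1) ^ k) * Rval_sgn b k).
Proof.
  intros Hk.
  assert (D : (b = false -> (2 <= k)%nat) \/ b = false /\ k = 1%nat).
  { destruct b; [left; discriminate|].
    destruct (Nat.le_gt_cases 2 k); [left; auto|right; split; [reflexivity|lia]]. }
  destruct D as [D|[-> ->]].
  - apply (is_lim_seq_scal_l _ _ (Finite _)), shalf_lim; auto.
  - unfold sgn; replace ((1 + 1 * (-1) ^ 1) * Rval_sgn false 1) with 0 by ring.
    apply is_lim_seq_ext with (fun _ => 0); [intros; ring|apply is_lim_seq_const].
Qed.

(** * The regularisation at p = 1 *)

Lemma ln_le_sub1 y : 0 < y -> ln y <= y - 1.
Proof.
  intros Hy; generalize (exp_ineq1_le (ln y)); rewrite exp_ln by exact Hy; lra.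
Qed.

Lemma ln_succ_bounds x : 0 < x -> / (x + 1) <= ln (x + 1) - ln x <= / x.
Proof.
  intros Hx; split.
  - assert (L := ln_le_sub1 (x / (x + 1))).
    rewrite ln_div in L by lra.
    replace (x / (x + 1) - 1) with (- / (x + 1)) in L by (field; lra).
    assert (0 < x / (x + 1)) by (apply Rdiv_lt_0_compat; lra). lra.
  - assert (L := ln_le_sub1 ((x + 1) / x)).
    rewrite ln_div in L by lra.
    replace ((x + 1) / x - 1) with (/ x) in L by (field; lra).
    assert (0 < (x + 1) / x) by (apply Rdiv_lt_0_compat; lra). lra.
Qed.

Lemma sharm1_S n : sharm 1 1 (S n) = sharm 1 1 n + / (INR n + 1).
Proof.
  change (sharm 1 1 n + 1 ^ S n / INR (S n) ^ 1 = sharm 1 1 n + / (INR n + 1)).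
  rewrite pow1, pow_1, S_INR; f_equal; apply Rmult_1_l.
Qed.

Lemma sharm1_block_ln r k : (1 <= r)%nat ->
  ln (INR (r + k)) - ln (INR r) + / INR (r + k) - / INR r
    <= sharm 1 1 (r + k) - sharm 1 1 r <= ln (INR (r + k)) - ln (INR r).
Proof.
  intros Hr; induction k as [|k IH].
  - rewrite Nat.add_0_r; lra.
  - rewrite <- plus_n_Sm, sharm1_S, S_INR.
    assert (P : 0 < INR (r + k)) by (apply lt_0_INR; lia).
    generalize (ln_succ_bounds (INR (r + k)) P); lra.
Qed.

(** Both sides grow by 1/(M+1/2) - 1/(M+1) when M does. *)
Lemma shalf1_sub_sharm1 M : shalf 1 1 M - sharm 1 1 M = 2 * (sharm 1 1 (M + M) - sharm 1 1 M).
Proof.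
  induction M as [|M IH]; [unfold shalf, sharm; simpl; ring|].
  replace (S M + S M)%nat with (S (S (M + M))) by lia.
  rewrite !sharm1_S.
  assert (E : shalf 1 1 (S M) = shalf 1 1 M + / (INR M + 1 / 2)).
  { change (shalf 1 1 M + 1 ^ M / (INR M + 1 / 2) ^ 1 = shalf 1 1 M + / (INR M + 1 / 2)).
    rewrite pow1, pow_1; f_equal; apply Rmult_1_l. }
  rewrite E; replace (shalf 1 1 M) with (shalf 1 1 M - sharm 1 1 M + sharm 1 1 M) by ring.
  rewrite IH, S_INR, plus_INR; generalize (pos_INR M); intros; field; lra.
Qed.

Lemma shalf1_sub_sharm1_lim : is_lim_seq (fun M => shalf 1 1 M - sharm 1 1 M) (2 * ln 2).
Proof.
  apply is_lim_seq_incr_1.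
  apply is_lim_seq_le_le with
    (u := fun M => 2 * ln 2 - / (INR M + 1) ^ 1) (w := fun _ => 2 * ln 2).
  - intros M; rewrite shalf1_sub_sharm1.
    assert (B := sharm1_block_ln (S M) (S M)); specialize (B ltac:(lia)).
    assert (P : 0 < INR (S M)) by (apply lt_0_INR; lia).
    rewrite plus_INR in B.
    replace (INR (S M) + INR (S M)) with (2 * INR (S M)) in B by ring.
    rewrite ln_mult in B by lra.
    replace (/ (2 * INR (S M))) with (/ INR (S M) / 2) in B by (field; lra).
    rewrite pow_1, <- S_INR; lra.
  - replace (Finite (2 * ln 2)) with (Finite (2 * ln 2 - 0)) by (f_equal; ring).
    apply is_lim_seq_minus'; [apply is_lim_seq_const|now apply is_lim_seq_inv_pow].
  - apply is_lim_seq_const.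
Qed.

(** In the divergent case the product of the signs is 1, so the signs agree and
    the two divergent sequences carry the same coefficient. *)
Lemma regularised_lim eb db p q : (1 <= p)%nat -> (2 <= q)%nat ->
  is_lim_seq
    (fun M => (1 + sgn eb * (-1) ^ q) * Rval_sgn eb q * shalf (sgn (xorb eb db)) p M
            - (1 + sgn db * (-1) ^ q) * Rval_sgn db q * sharm (sgn (xorb eb db)) p M)
    ((1 + sgn eb * (-1) ^ q) * Rval_sgn eb q * Rval_sgn (xorb eb db) p
     - (1 + sgn db * (-1) ^ q) * Rval_sgn db q * zeta_sgn (xorb eb db) p).
Proof.
  intros Hp Hq.
  assert (D : (xorb eb db = false -> (2 <= p)%nat) \/ xorb eb db = false /\ p = 1%nat).
  { destruct (xorb eb db); [left; discriminate|].
    destruct (Nat.le_gt_cases 2 p); [left; auto|right; split; [reflexivity|lia]]. }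
  destruct D as [D|[D ->]].
  - apply is_lim_seq_minus'; apply (is_lim_seq_scal_l _ _ (Finite _));
      [apply shalf_lim|apply sharm_lim]; auto.
  - rewrite D; apply Bool.xorb_eq in D; subst db.
    change (sgn false) with 1; change (Rval_sgn false 1) with (2 * ln 2).
    change (zeta_sgn false 1) with 0.
    set (c := (1 + sgn eb * (-1) ^ q) * Rval_sgn eb q).
    apply is_lim_seq_ext with (fun M => c * (shalf 1 1 M - sharm 1 1 M)).
    { intros M; ring. }
    replace (c * (2 * ln 2) - c * 0) with (c * (2 * ln 2)) by ring.
    apply (is_lim_seq_scal_l _ _ (Finite _)), shalf1_sub_sharm1_lim.
Qed.

(** * Rows: the half-integer a = m + 1/2 is fixed *)

Lemma pcomb_ext P Q a v w :
  (forall i, (1 <= i)%nat -> v i = w i) -> pcomb P Q a v = pcomb P Q a w.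
Proof. intros E; apply psum_ext; intros i _; rewrite E; [reflexivity|lia]. Qed.

Lemma pcomb_lin P Q a c v w :
  pcomb P Q a (fun i => v i + c * w i) = pcomb P Q a v + c * pcomb P Q a w.
Proof.
  unfold pcomb; rewrite <- psum_scal, <- psum_plus; apply psum_ext; intros; ring.
Qed.

Lemma pcomb_psum P Q a (c : nat -> R) (v : nat -> nat -> R) N :
  psum (fun n => c n * pcomb P Q a (v n)) N
  = pcomb P Q a (fun i => psum (fun n => c n * v n i) N).
Proof.
  unfold pcomb.
  rewrite (psum_ext _ (fun n => psum (fun i => pcoef P Q a i * (c n * v n (S i))) (S P))).
  2:{ intros n _; rewrite <- psum_scal; apply psum_ext; intros; ring. }
  rewrite psum_exchange; apply psum_ext; intros i _; now rewrite psum_scal.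
Qed.

Lemma pcomb_lim P Q a (v : nat -> nat -> R) (l : nat -> R) :
  (forall i, (1 <= i)%nat -> is_lim_seq (v i) (l i)) ->
  is_lim_seq (fun N => pcomb P Q a (fun i => v i N)) (pcomb P Q a l).
Proof.
  intros L.
  apply (is_lim_seq_psum (fun i N => pcoef P Q a i * v (S i) N)
           (fun i => pcoef P Q a i * l (S i))).
  intros i _; apply (is_lim_seq_scal_l _ _ (Finite _)), L; lia.
Qed.

(** With k = n - m and k = -(n+1) - m, the second being the mirror image of the
    first under n -> -1-n, the two terms are those with k + a = n + 1/2 and
    k + a = -(n + 1/2). *)
Definition row (e : R) (P Q m N : nat) : R :=
  psum (fun n => e ^ (n + m) *
     (/ ((INR n - INR m) ^ S P * (INR n + 1 / 2) ^ S Q)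
      + e * / ((- (INR n + 1 + INR m)) ^ S P * (- (INR n + 1 / 2)) ^ S Q))) N.

(** Partial fractions at every [n], with the missing term k = 0, that is [n = m],
    added and subtracted: there the first summand of the row and its principal
    part at k = 0 both vanish, by [/ 0 = 0], but the other principal part does not. *)
Lemma row_expand e P Q m N : e * e = 1 -> (m < N)%nat ->
  row e P Q m N =
    pcomb P Q (INR m + 1 / 2)
      (fun i => (-1) ^ i * (spunct e i m N + (sharm e i (m + N) - sharm e i m)))
    + e ^ m * pcomb Q P (- (INR m + 1 / 2))
      (fun j => (1 + e * (-1) ^ j) * shalf e j N)
    - ppart Q P (INR m + 1 / 2) (- (INR m + 1 / 2)).
Proof.
  intros He Hm; set (a := INR m + 1 / 2).
  assert (Hma := pos_INR m).
  unfold row.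
  rewrite (psum_ext _ (fun n =>
      (e ^ (n + m) * pcomb P Q a
         (fun i => / (INR n - INR m) ^ i + e * / (- (INR n + 1 + INR m)) ^ i)
     + e ^ (n + m) * pcomb Q P (- a)
         (fun j => / (INR n + 1 / 2) ^ j + e * / (- (INR n + 1 / 2)) ^ j))
     + (-1) * (if Nat.eq_dec n m then ppart Q P a (- a) else 0))).
  - rewrite !psum_plus, psum_scal, psum_delta, !pcomb_psum by exact Hm.
    assert (Sub : forall u v w x y, u = w -> v = x -> u + v + (-1) * y = w + x - y)
      by (intros; subst; ring).
    apply Sub; clear Sub.
    + apply pcomb_ext; intros i Hi; cbv beta.
      unfold spunct; rewrite sharm_add, <- psum_plus, <- psum_scal.
      apply psum_ext; intros n _.
      replace (m + S n)%nat with (S (n + m)) by lia.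
      replace (INR (S (n + m))) with (INR n + 1 + INR m)
        by (rewrite S_INR, plus_INR; ring).
      replace (INR n - INR m) with (- (INR m - INR n)) by ring.
      rewrite (Nat.add_comm m n), !inv_pow_opp.
      change (e ^ S (n + m)) with (e * e ^ (n + m)); unfold Rdiv; ring.
    + transitivity (pcomb Q P (- a)
        (fun j => 0 + e ^ m * ((1 + e * (-1) ^ j) * shalf e j N))).
      * apply pcomb_ext; intros j Hj; cbv beta; unfold shalf.
        rewrite Rplus_0_l, <- !psum_scal; apply psum_ext; intros n _.
        rewrite inv_pow_opp, pow_add; unfold Rdiv; ring.
      * rewrite pcomb_lin; unfold pcomb at 1.
        rewrite (psum_ext _ (fun _ => 0)), psum_zero by (intros; ring); ring.
  - intros n _; assert (Hn := pos_INR n).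
    rewrite !pcomb_lin; fold (ppart P Q (INR n - INR m) a)
      (ppart P Q (- (INR n + 1 + INR m)) a)
      (ppart Q P (INR n + 1 / 2) (- a)) (ppart Q P (- (INR n + 1 / 2)) (- a)).
    rewrite (partial_fractions P Q (- (INR n + 1 + INR m)) (- (INR n + 1 / 2)))
      by lra.
    replace (- (INR n + 1 / 2) - - (INR n + 1 + INR m)) with a by (unfold a; field).
    replace (- (INR n + 1 + INR m) - - (INR n + 1 / 2)) with (- a) by (unfold a; field).
    destruct (Nat.eq_dec n m) as [->|Hnm].
    + replace (INR m - INR m) with 0 by ring.
      replace (ppart P Q 0 a) with 0.
      2:{ unfold ppart, pcomb; rewrite (psum_ext _ (fun _ => 0)); [now rewrite psum_zero|].
          intros i _; rewrite pow_i by lia; rewrite Rinv_0; ring. }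
      rewrite (pow_i (S P)) by lia; rewrite Rmult_0_l, Rinv_0.
      replace (m + m)%nat with (2 * m)%nat by lia.
      rewrite sign_pow_even by exact He; fold a; ring.
    + assert (INR n <> INR m) by (now apply not_INR).
      rewrite (partial_fractions P Q (INR n - INR m) (INR n + 1 / 2)) by lra.
      replace (INR n + 1 / 2 - (INR n - INR m)) with a by (unfold a; field).
      replace (INR n - INR m - (INR n + 1 / 2)) with (- a) by (unfold a; field).
      ring.
Qed.

Definition row_lim (b : bool) (P Q m : nat) : R :=
  pcomb P Q (INR m + 1 / 2) (fun i => (1 + (-1) ^ i) * zeta_sgn b i)
  + sgn b ^ m * pcomb Q P (- (INR m + 1 / 2)) (fun j => (1 + sgn b * (-1) ^ j) * Rval_sgn b j)
  - ppart Q P (INR m + 1 / 2) (- (INR m + 1 / 2)).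

(** The sums over k are symmetric up to a block of [m] or so terms, which
    vanishes in the limit, so that the conditionally convergent i = 1 is no
    exception. *)
Lemma row_cv b P Q m : is_lim_seq (row (sgn b) P Q m) (row_lim b P Q m).
Proof.
  assert (He := sgn_sq b).
  eapply is_lim_seq_ext_loc.
  { exists (S m); intros N HN; symmetry; apply row_expand; [exact He|exact HN]. }
  apply is_lim_seq_minus'; [apply is_lim_seq_plus'|apply is_lim_seq_const].
  - apply (pcomb_lim P Q _
      (fun i N => (-1) ^ i * (spunct (sgn b) i m N
                    + (sharm (sgn b) i (m + N) - sharm (sgn b) i m)))).
    intros i Hi.
    apply is_lim_seq_ext with (fun N =>
      (-1) ^ i * (spunct (sgn b) i m N - sharm (sgn b) i m - (-1) ^ i * sharm (sgn b) i N)
      + (-1) ^ i * (sharm (sgn b) i (N + m) - sharm (sgn b) i N)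
      + (1 + (-1) ^ i) * sharm (sgn b) i N).
    { intros N; rewrite (Nat.add_comm N m).
      assert (E := sign_pow_even (-1) i neg1_sq).
      replace (2 * i)%nat with (i + i)%nat in E by lia; rewrite pow_add in E.
      replace (sharm (sgn b) i N) with ((-1) ^ i * (-1) ^ i * sharm (sgn b) i N) at 3
        by (rewrite E; ring).
      replace (sharm (sgn b) i N) with ((-1) ^ i * (-1) ^ i * sharm (sgn b) i N) at 2
        by (rewrite E; ring).
      ring_simplify; nra. }
    replace (Finite ((1 + (-1) ^ i) * zeta_sgn b i))
      with (Finite ((-1) ^ i * 0 + (-1) ^ i * 0 + (1 + (-1) ^ i) * zeta_sgn b i))
      by (f_equal; ring).
    apply is_lim_seq_plus'; [apply is_lim_seq_plus'|now apply sharm_even_lim];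
      apply (is_lim_seq_scal_l _ _ (Finite _)).
    + now apply spunct_lim.
    + now apply sharm_block_lim.
  - apply (is_lim_seq_scal_l _ _ (Finite _)).
    apply (pcomb_lim Q P _ (fun j N => (1 + sgn b * (-1) ^ j) * shalf (sgn b) j N)).
    intros j Hj; now apply shalf_even_lim.
Qed.

(** * Columns: the half-integer b = n + 1/2 is fixed *)

(** The terms of b and -b together, over all [m < M]. *)
Definition col (e d : R) (P Q M n : nat) : R :=
  d ^ n / (INR n + 1 / 2) ^ S Q *
    (spunct (e * d) (S P) n M
     + d * (-1) ^ (S P + S Q) * (sharm (e * d) (S P) (n + M) - sharm (e * d) (S P) n)).

Lemma rows_cols e d P Q M N : e * e = 1 -> d * d = 1 ->
  psum (fun m => d ^ m * row e P Q m N) M = psum (col e d P Q M) N.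
Proof.
  intros He Hd.
  rewrite (psum_ext _ (fun m => psum (fun n => d ^ m * (e ^ (n + m) *
     (/ ((INR n - INR m) ^ S P * (INR n + 1 / 2) ^ S Q)
      + e * / ((- (INR n + 1 + INR m)) ^ S P * (- (INR n + 1 / 2)) ^ S Q)))) N))
    by (intros; unfold row; now rewrite psum_scal).
  rewrite psum_exchange; apply psum_ext; intros n _.
  unfold col, spunct; rewrite sharm_add, <- psum_scal, <- psum_plus, <- psum_scal.
  apply psum_ext; intros m _.
  assert (E : d ^ n * d ^ (n + m) = d ^ m).
  { rewrite <- pow_add; apply sign_pow_cancel with n; [exact Hd|lia]. }
  rewrite !Rpow_mult_distr.
  replace (n + S m)%nat with (S (n + m)) by lia.
  replace (INR (S (n + m))) with (INR n + 1 + INR m) by (rewrite S_INR, plus_INR; ring).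
  rewrite !Rinv_mult, !inv_pow_opp, <- E.
  change (e ^ S (n + m)) with (e * e ^ (n + m)).
  change (d ^ S (n + m)) with (d * d ^ (n + m)).
  rewrite (pow_add (-1)); unfold Rdiv.
  generalize (e ^ (n + m)) (d ^ (n + m)) (d ^ n) ((-1) ^ S P) ((-1) ^ S Q)
    (/ (INR n - INR m) ^ S P) (/ (INR n + 1 / 2) ^ S Q)
    (/ (INR n + 1 + INR m) ^ S P); intros; ring [Hd].
Qed.

Lemma col_is_series eb db P Q M :
  is_series (col (sgn eb) (sgn db) P Q M)
    (psum (fun m => sgn db ^ m * row_lim eb P Q m) M).
Proof.
  apply is_series_psum.
  apply is_lim_seq_ext with (fun N => psum (fun m => sgn db ^ m * row (sgn eb) P Q m N) M).
  { intros N; apply rows_cols; apply sgn_sq. }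
  apply (is_lim_seq_psum (fun m N => sgn db ^ m * row (sgn eb) P Q m N)).
  intros m _; apply (is_lim_seq_scal_l _ _ (Finite _)), row_cv.
Qed.

(** [eb] and [db] are the signs e and d of the double sum: d goes with the
    half-integer and e d with the harmonic number. *)
Definition euler_sum (eb db : bool) (p q : nat) : R :=
  Series (fun n => sgn db ^ n / (INR n + 1 / 2) ^ q * sharm (sgn (xorb eb db)) p n).

Lemma sgn_xorb eb db : sgn (xorb eb db) = sgn eb * sgn db.
Proof. destruct eb, db; simpl; ring. Qed.

Lemma weight_bound b q n x y : 
  Rabs x <= y -> Rabs (sgn b ^ n / (INR n + 1 / 2) ^ q * x) <= y / (INR n + 1 / 2) ^ q.
Proof.
  intros L; assert (N := pos_INR n).
  assert (P : 0 < / (INR n + 1 / 2) ^ q) by (apply Rinv_0_lt_compat, pow_lt; lra).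
  unfold Rdiv; rewrite !Rabs_mult, sign_Rabs by apply sgn_sq.
  rewrite (Rabs_pos_eq (/ _)) by lra; rewrite Rmult_1_l, Rmult_comm.
  apply Rmult_le_compat_r; lra.
Qed.

(** * The limit of the double sum *)

(** The column [n] tends to its limit only after subtraction of a multiple of the
    [M]-th harmonic sum, which need not converge.  What is left is bounded by
    3 H_(n+1) / (n+1/2)^q for all [M], so [tannery] applies. *)
Lemma rows_lim eb db P Q : (1 <= Q)%nat ->
  is_lim_seq
    (fun M => psum (fun m => sgn db ^ m * row_lim eb P Q m) M
       - ((-1) ^ S P + sgn db * (-1) ^ (S P + S Q)) * Rval_sgn db (S Q)
         * sharm (sgn (xorb eb db)) (S P) M)
    ((1 - sgn db * (-1) ^ (S P + S Q)) * euler_sum eb db (S P) (S Q)).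
Proof.
  intros HQ.
  set (s := sgn db * (-1) ^ (S P + S Q)); set (h := sharm (sgn (xorb eb db)) (S P)).
  set (w := fun n => sgn db ^ n / (INR n + 1 / 2) ^ S Q).
  assert (Hs : Rabs s = 1).
  { unfold s; rewrite Rabs_mult, (sign_Rabs (-1)) by apply neg1_sq.
    rewrite <- (pow_1 (sgn db)), sign_Rabs by apply sgn_sq; ring. }
  assert (He := sgn_sq (xorb eb db)).
  assert (Xg : ex_series (fun n => 3 * (sharm 1 1 (S n) / (INR n + 1 / 2) ^ S Q))).
  { apply (ex_series_scal (V := R_NormedModule) 3), ex_series_sharm1_weight; lia. }
  assert (Xw : is_series w (Rval_sgn db (S Q))).
  { apply is_series_psum, shalf_lim; [lia|intros _; lia]. }
  assert (I : forall n, 0 <= sharm 1 1 n <= sharm 1 1 (S n)).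
  { intros n; split; [apply (sharm1_incr 0 n); lia|apply sharm1_incr; lia]. }
  assert (Xh : ex_series (fun n => w n * h n)).
  { eapply (ex_series_le (K := R_AbsRing) (V := R_CompleteNormedModule)); [|exact Xg].
    intros n; cbv beta; unfold w.
    eapply Rle_trans; [apply (weight_bound db (S Q) n (h n) (3 * sharm 1 1 (S n)))|].
    - eapply Rle_trans; [apply sharm_bound; [exact He|lia]|].
      specialize (I n); lra.
    - unfold Rdiv; rewrite Rmult_assoc; apply Rle_refl. }
  (* the column minus its limit and minus the subtracted term; the constants
     are arranged so that both brackets tend to 0 *)
  set (f := fun M n => w n *
     ((spunct (sgn (xorb eb db)) (S P) n M - h n - (-1) ^ S P * h M)
      + s * (h (M + n)%nat - h M))).
  assert (L : is_lim_seq (fun M => Series (f M)) 0).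
  { apply tannery with (g := fun n => 3 * (sharm 1 1 (S n) / (INR n + 1 / 2) ^ S Q));
      [|exact Xg|].
    - intros M n; unfold f, w.
      eapply Rle_trans; [apply (weight_bound db (S Q) n _ (3 * sharm 1 1 (S n)))|].
      + eapply Rle_trans; [apply Rabs_triang|].
        rewrite Rabs_mult, Hs.
        assert (B1 := spunct_bound (sgn (xorb eb db)) (S P) n M He ltac:(lia)).
        assert (B2 := sharm_block_bound (sgn (xorb eb db)) (S P) M n He ltac:(lia)).
        specialize (I n); unfold h; lra.
      + unfold Rdiv; rewrite Rmult_assoc; apply Rle_refl.
    - intros n; unfold f.
      replace (Finite 0) with (Finite (w n * (0 + s * 0))) by (f_equal; ring).
      apply (is_lim_seq_scal_l _ _ (Finite _)), is_lim_seq_plus';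
        [|apply (is_lim_seq_scal_l _ _ (Finite _))].
      + apply spunct_lim; [exact He|lia].
      + apply sharm_block_lim; [exact He|lia]. }
  replace ((1 - s) * euler_sum eb db (S P) (S Q))
    with (0 + (1 - s) * euler_sum eb db (S P) (S Q)) by ring.
  apply is_lim_seq_ext with
    (fun M => Series (f M) + (1 - s) * euler_sum eb db (S P) (S Q));
    [|apply is_lim_seq_plus'; [exact L|apply is_lim_seq_const]].
  intros M.
  assert (Xc := col_is_series eb db P Q M).
  rewrite <- (is_series_unique _ _ Xc).
  assert (Ec : ex_series (col (sgn eb) (sgn db) P Q M)) by (eexists; exact Xc).
  rewrite <- (is_series_unique _ _ Xw).
  assert (Ew : ex_series w) by (eexists; exact Xw).
  rewrite (Series_ext (f M) (fun n => col (sgn eb) (sgn db) P Q M n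
     - ((1 - s) * (w n * h n) + ((-1) ^ S P + s) * h M * w n))).
  - rewrite Series_minus, Series_plus, !Series_scal_l.
    + unfold euler_sum; fold h; fold w.
      change (Series (fun n => sgn db ^ n / (INR n + 1 / 2) ^ S Q * h n))
        with (Series (fun n => w n * h n)); ring.
    + now apply (ex_series_scal (V := R_NormedModule) (1 - s)).
    + now apply (ex_series_scal (V := R_NormedModule) (((-1) ^ S P + s) * h M)).
    + exact Ec.
    + apply (ex_series_plus (V := R_NormedModule));
        [now apply (ex_series_scal (V := R_NormedModule) (1 - s))
        |now apply (ex_series_scal (V := R_NormedModule) (((-1) ^ S P + s) * h M))].
  - intros n; unfold f, col; rewrite <- sgn_xorb; fold s; fold (w n).
    unfold h; rewrite (Nat.add_comm n M); ring.
Qed.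

(** The contribution of the excluded k = 0, where k + a = a. *)
Lemma ppart_diag P Q a :
  ppart Q P a (- a) = (-1) ^ S P * binom (S P + Q) (S P) / a ^ (S P + S Q).
Proof.
  transitivity ((-1) ^ S P * / a ^ (S P + S Q) * binom (S P + Q) (S P));
    [|unfold Rdiv; ring].
  rewrite <- binom_hockey, <- psum_scal; unfold ppart, pcomb.
  apply psum_ext; intros j Hj; cbv beta; unfold pcoef, Rdiv; rewrite inv_pow_opp.
  assert (E : (-1) ^ S P = (-1) ^ (Q - j) * (-1) ^ (S P + (Q - j))).
  { rewrite <- pow_add; symmetry; apply sign_pow_cancel with (Q - j)%nat;
      [apply neg1_sq|lia]. }
  replace (S P + S Q)%nat with ((S P + (Q - j)) + S j)%nat by lia.
  rewrite E, (pow_add a _ (S j)), Rinv_mult; ring.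
Qed.

(** Summing the rows turns each power of m + 1/2 into a partial sum of an R-value.
    The sign [(-1) ^ (P - i)] becomes [(-1) ^ S P] because only odd [i] count. *)
Lemma rows_expand eb db P Q M :
  psum (fun m => sgn db ^ m * row_lim eb P Q m) M
  = (-1) ^ S P * psum (fun i => (1 + (-1) ^ S i) * binom (Q + (P - i)) Q
       * zeta_sgn eb (S i) * shalf (sgn db) (S Q + (P - i)) M) (S P)
  + (-1) ^ S P * psum (fun j => (1 + sgn eb * (-1) ^ S j) * binom (P + (Q - j)) P
       * Rval_sgn eb (S j) * shalf (sgn (xorb eb db)) (S P + (Q - j)) M) (S Q)
  - (-1) ^ S P * binom (S P + Q) (S P) * shalf (sgn db) (S P + S Q) M.
Proof.
  assert (T : forall u v w u' v' w', u = u' -> v = v' -> w = w' ->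
    u + v + (-1) * w = u' + v' - w') by (intros; subst; ring).
  unfold row_lim.
  rewrite (psum_ext _ (fun m =>
      sgn db ^ m * pcomb P Q (INR m + 1 / 2) (fun i => (1 + (-1) ^ i) * zeta_sgn eb i)
      + sgn (xorb eb db) ^ m * pcomb Q P (- (INR m + 1 / 2))
           (fun j => (1 + sgn eb * (-1) ^ j) * Rval_sgn eb j)
      + (-1) * (sgn db ^ m * ppart Q P (INR m + 1 / 2) (- (INR m + 1 / 2))))).
  2:{ intros m _; rewrite sgn_xorb, Rpow_mult_distr; ring. }
  rewrite !psum_plus, psum_scal; apply T; clear T.
  - unfold pcomb.
    rewrite (psum_ext _ (fun m => psum (fun i => sgn db ^ m *
       (pcoef P Q (INR m + 1 / 2) i * ((1 + (-1) ^ S i) * zeta_sgn eb (S i)))) (S P)))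
      by (intros; now rewrite psum_scal).
    rewrite psum_exchange, <- psum_scal; apply psum_ext; intros i Hi.
    unfold shalf; rewrite <- !psum_scal; apply psum_ext; intros m _; unfold pcoef.
    assert (E : (-1) ^ (P - i) = (-1) ^ S P * (-1) ^ S i).
    { rewrite <- pow_add; symmetry; apply sign_pow_cancel with (S i);
        [apply neg1_sq|lia]. }
    assert (E2 : (-1) ^ S i * (-1) ^ S i = 1).
    { rewrite <- pow_add; replace (S i + S i)%nat with (2 * S i)%nat by lia.
      apply sign_pow_even, neg1_sq. }
    rewrite E; unfold Rdiv; generalize dependent ((-1) ^ S i); intros y _ E2.
    ring [E2].
  - unfold pcomb.
    rewrite (psum_ext _ (fun m => psum (fun j => sgn (xorb eb db) ^ m *
       (pcoef Q P (- (INR m + 1 / 2)) j * ((1 + sgn eb * (-1) ^ S j) * Rval_sgn eb (S j)))) (S Q)))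
      by (intros; now rewrite psum_scal).
    rewrite psum_exchange, <- psum_scal; apply psum_ext; intros j Hj.
    unfold shalf; rewrite <- !psum_scal; apply psum_ext; intros m _; unfold pcoef, Rdiv.
    rewrite inv_pow_opp.
    assert (E : (-1) ^ S P = (-1) ^ (Q - j) * (-1) ^ (S P + (Q - j))).
    { rewrite <- pow_add; symmetry; apply sign_pow_cancel with (Q - j)%nat;
        [apply neg1_sq|lia]. }
    rewrite E; ring.
  - unfold shalf; rewrite <- psum_scal; apply psum_ext; intros m _.
    rewrite ppart_diag; unfold Rdiv; ring.
Qed.

(** The two limits of the double sum agree.  For j = Q the R-value has index
    [S P], which may be 1; that term alone need not converge and is paired with
    the harmonic sum as in [regularised_lim]. *)
Lemma parity_psum eb db P Q : (1 <= Q)%nat ->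
  (1 - sgn db * (-1) ^ (S P + S Q)) * euler_sum eb db (S P) (S Q)
  = (-1) ^ S P * psum (fun i => (1 + (-1) ^ S i) * binom (Q + (P - i)) Q
       * zeta_sgn eb (S i) * Rval_sgn db (S Q + (P - i))) (S P)
  + (-1) ^ S P * psum (fun j => (1 + sgn eb * (-1) ^ S j) * binom (P + (Q - j)) P
       * Rval_sgn eb (S j) * Rval_sgn (xorb eb db) (S P + (Q - j))) (S Q)
  - (-1) ^ S P * binom (S P + Q) (S P) * Rval_sgn db (S P + S Q)
  - (-1) ^ S P * (1 + sgn db * (-1) ^ S Q) * zeta_sgn (xorb eb db) (S P) * Rval_sgn db (S Q).
Proof.
  intros HQ.
  assert (L := rows_lim eb db P Q HQ).
  set (c1 := fun i => (1 + (-1) ^ S i) * binom (Q + (P - i)) Q * zeta_sgn eb (S i)).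
  set (c2 := fun j => (1 + sgn eb * (-1) ^ S j) * binom (P + (Q - j)) P * Rval_sgn eb (S j)).
  set (c3 := (-1) ^ S P * binom (S P + Q) (S P)).
  assert (L2 : is_lim_seq
    (fun M => (-1) ^ S P * psum (fun i => c1 i * shalf (sgn db) (S Q + (P - i)) M) (S P)
      + (-1) ^ S P * psum (fun j => c2 j * shalf (sgn (xorb eb db)) (S P + (Q - j)) M) Q
      - c3 * shalf (sgn db) (S P + S Q) M
      + (-1) ^ S P *
        ((1 + sgn eb * (-1) ^ S Q) * Rval_sgn eb (S Q) * shalf (sgn (xorb eb db)) (S P) M
         - (1 + sgn db * (-1) ^ S Q) * Rval_sgn db (S Q) * sharm (sgn (xorb eb db)) (S P) M))
    ((-1) ^ S P * psum (fun i => c1 i * Rval_sgn db (S Q + (P - i))) (S P)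
      + (-1) ^ S P * psum (fun j => c2 j * Rval_sgn (xorb eb db) (S P + (Q - j))) Q
      - c3 * Rval_sgn db (S P + S Q)
      + (-1) ^ S P *
        ((1 + sgn eb * (-1) ^ S Q) * Rval_sgn eb (S Q) * Rval_sgn (xorb eb db) (S P)
         - (1 + sgn db * (-1) ^ S Q) * Rval_sgn db (S Q) * zeta_sgn (xorb eb db) (S P)))).
  { apply is_lim_seq_plus'; [apply is_lim_seq_minus'; [apply is_lim_seq_plus'|]|];
      apply (is_lim_seq_scal_l _ _ (Finite _)).
    - apply (is_lim_seq_psum (fun i M => c1 i * shalf (sgn db) (S Q + (P - i)) M)
               (fun i => c1 i * Rval_sgn db (S Q + (P - i)))).
      intros i Hi; apply (is_lim_seq_scal_l _ _ (Finite _)), shalf_lim; lia.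
    - apply (is_lim_seq_psum (fun j M => c2 j * shalf (sgn (xorb eb db)) (S P + (Q - j)) M)
               (fun j => c2 j * Rval_sgn (xorb eb db) (S P + (Q - j)))).
      intros i Hi; apply (is_lim_seq_scal_l _ _ (Finite _)), shalf_lim; lia.
    - apply shalf_lim; lia.
    - apply regularised_lim; lia. }
  assert (Ec2 : c2 Q = (1 + sgn eb * (-1) ^ S Q) * Rval_sgn eb (S Q)).
  { unfold c2; rewrite Nat.sub_diag, Nat.add_0_r, binom_n_n; ring. }
  assert (Es : (-1) ^ (S P + S Q) = (-1) ^ S P * (-1) ^ S Q) by apply pow_add.
  eapply is_lim_seq_ext in L2.
  - assert (U := is_lim_seq_unique _ _ L); rewrite (is_lim_seq_unique _ _ L2) in U.
    apply (f_equal real) in U; cbn [real] in U; rewrite <- U; clear U.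
    change (psum ?f (S Q)) with (psum f Q + f Q); cbv beta.
    fold (c2 Q); rewrite Ec2, Nat.sub_diag, Nat.add_0_r.
    unfold c1, c2, c3; ring.
  - intros M; cbv beta; rewrite rows_expand.
    change (psum ?f (S Q)) with (psum f Q + f Q); cbv beta.
    fold (c2 Q); rewrite Ec2, Nat.sub_diag, Nat.add_0_r, Es.
    unfold c1, c2, c3; ring.
Qed.

(** * The four identities *)

(** The correction term becomes the summand j = 0 through zeta(0) = -1/2. *)
Lemma parity_sum_f_R0 eb db p q : (1 <= p)%nat -> (2 <= q)%nat ->
  (1 - sgn db * (-1) ^ (p + q)) * euler_sum eb db p q
  = (-1) ^ p * sum_f_R0 (fun j => (1 + (-1) ^ j) * binom (p + q - j - 1) (q - 1)
        * zeta_sgn eb j * Rval_sgn db (p + q - j)) p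
  + (-1) ^ p * sum_f_R0 (fun k => (1 - sgn eb * (-1) ^ k) * binom (p + q - k - 2) (p - 1)
        * Rval_sgn eb (k + 1) * Rval_sgn (xorb eb db) (p + q - k - 1)) (q - 1)
  - (-1) ^ p * (1 + sgn db * (-1) ^ q) * zeta_sgn (xorb eb db) p * Rval_sgn db q.
Proof.
  intros Hp Hq.
  destruct p as [|P]; [lia|]; destruct q as [|Q]; [lia|].
  rewrite parity_psum by lia; rewrite !sum_f_R0_psum, (psum_recl _ (S P)).
  replace (S Q - 1)%nat with Q by lia; replace (S P - 1)%nat with P by lia.
  rewrite (psum_ext _ (fun i => (1 + (-1) ^ S i) * binom (S P + S Q - S i - 1) Q *
     zeta_sgn eb (S i) * Rval_sgn db (S P + S Q - S i)) (S P)).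
  2:{ intros i Hi; replace (S P + S Q - S i - 1)%nat with (Q + (P - i))%nat by lia.
      now replace (S P + S Q - S i)%nat with (S Q + (P - i))%nat by lia. }
  rewrite (psum_ext _ (fun k => (1 - sgn eb * (-1) ^ k) * binom (S P + S Q - k - 2) P *
       Rval_sgn eb (k + 1) * Rval_sgn (xorb eb db) (S P + S Q - k - 1)) (S Q)).
  2:{ intros k Hk; replace (S P + S Q - k - 2)%nat with (P + (Q - k))%nat by lia.
      replace (S P + S Q - k - 1)%nat with (S P + (Q - k))%nat by lia.
      replace (k + 1)%nat with (S k) by lia; simpl; ring. }
  replace (S P + S Q - 0 - 1)%nat with (S P + Q)%nat by lia.
  replace (S P + S Q - 0)%nat with (S P + S Q)%nat by lia.
  rewrite (pascal_step1 (S P + Q) Q) by lia.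
  replace (S P + Q - Q)%nat with (S P) by lia.
  replace (zeta_sgn eb 0) with (- (1 / 2)) by now destruct eb.
  rewrite pow_O; field.
Qed.

Lemma sum_n_m_psum f n : sum_n_m f 1 n = psum (fun k => f (S k)) n.
Proof.
  induction n as [|n IH]; [now rewrite sum_n_m_zero by lia|].
  now rewrite sum_n_Sm by lia; rewrite IH.
Qed.

Lemma sharm_H p n : sharm 1 p n = H p n.
Proof.
  unfold H; rewrite sum_n_m_psum; apply psum_ext; intros k _.
  rewrite pow1; apply Rmult_1_l.
Qed.

Lemma sharm_Hb p n : sharm (-1) p n = - Hb p n.
Proof.
  unfold Hb; rewrite sum_n_m_psum.
  transitivity (-1 * psum (fun k => (-1) ^ (S k - 1) / INR (S k) ^ p) n); [|ring].
  rewrite <- psum_scal; apply psum_ext; intros k _.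
  replace (S k - 1)%nat with k by lia; simpl pow; unfold Rdiv; ring.
Qed.

Lemma sum_f_R0_ext f g n : (forall i, f i = g i) -> sum_f_R0 f n = sum_f_R0 g n.
Proof. intros E; apply sum_eq; auto. Qed.

Lemma sum_f_R0_opp f g n :
  (forall i, f i = - g i) -> sum_f_R0 f n = - sum_f_R0 g n.
Proof.
  intros E; rewrite !sum_f_R0_psum, (psum_ext f (fun i => -1 * g i)), psum_scal; [ring|].
  intros i _; rewrite E; ring.
Qed.

Lemma euler_sum_ff p q : euler_sum false false p q = Rsum p q.
Proof.
  apply Series_ext; intros n; simpl sgn; rewrite sharm_H, pow1; unfold Rdiv; ring.
Qed.

Lemma euler_sum_tf p q : euler_sum true false p q = - Rsum_b_ p q.
Proof.
  unfold Rsum_b_; rewrite <- Series_opp; apply Series_ext; intros n; simpl sgn.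
  rewrite sharm_Hb, pow1; unfold Rdiv; ring.
Qed.

Lemma euler_sum_ft p q : euler_sum false true p q = - Rsum_bb p q.
Proof.
  unfold Rsum_bb; rewrite <- Series_opp; apply Series_ext; intros n; simpl sgn.
  rewrite sharm_Hb; unfold Rdiv; ring.
Qed.

Lemma euler_sum_tt p q : euler_sum true true p q = Rsum__b p q.
Proof.
  apply Series_ext; intros n; simpl sgn; rewrite sharm_H; unfold Rdiv; ring.
Qed.

Theorem corollary3p2 (p q : nat) (hp : (1 <= p)%nat) (hq : (2 <= q)%nat) :
  (1 - (-1) ^ (p + q)) * Rsum p q =
      (-1) ^ p * sum_f_R0 (fun j =>
          (1 + (-1) ^ j) * binom (p + q - j - 1) (q - 1)
            * zeta j * Rval (p + q - j)) p
    + (-1) ^ p * sum_f_R0 (fun k =>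
          (1 - (-1) ^ k) * binom (p + q - k - 2) (p - 1)
            * Rval (k + 1) * Rval (p + q - k - 1)) (q - 1)
    - (-1) ^ p * (1 + (-1) ^ q) * zeta p * Rval q
  /\
  (1 - (-1) ^ (p + q)) * Rsum_b_ p q =
    - (-1) ^ p * sum_f_R0 (fun j =>
          (1 + (-1) ^ j) * binom (p + q - j - 1) (q - 1)
            * zetab j * Rval (p + q - j)) p
    - (-1) ^ p * sum_f_R0 (fun k =>
          (1 + (-1) ^ k) * binom (p + q - k - 2) (p - 1)
            * Rvalb (k + 1) * Rvalb (p + q - k - 1)) (q - 1)
    + (-1) ^ p * (1 + (-1) ^ q) * zetab p * Rval q
  /\
  (1 + (-1) ^ (p + q)) * Rsum_bb p q =
      (-1) ^ p * sum_f_R0 (fun j =>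
          (1 + (-1) ^ j) * binom (p + q - j - 1) (q - 1)
            * zeta j * Rvalb (p + q - j)) p
    + (-1) ^ p * sum_f_R0 (fun k =>
          (1 - (-1) ^ k) * binom (p + q - k - 2) (p - 1)
            * Rval (k + 1) * Rvalb (p + q - k - 1)) (q - 1)
    - (-1) ^ p * (1 - (-1) ^ q) * zetab p * Rvalb q
  /\
  (1 + (-1) ^ (p + q)) * Rsum__b p q =
    - (-1) ^ p * sum_f_R0 (fun j =>
          (1 + (-1) ^ j) * binom (p + q - j - 1) (q - 1)
            * zetab j * Rvalb (p + q - j)) p
    - (-1) ^ p * sum_f_R0 (fun k =>
          (1 + (-1) ^ k) * binom (p + q - k - 2) (p - 1)
            * Rvalb (k + 1) * Rval (p + q - k - 1)) (q - 1)
    + (-1) ^ p * (1 - (-1) ^ q) * zeta p * Rvalb q.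
Proof.
  assert (I := fun eb db => parity_sum_f_R0 eb db p q hp hq).
  split; [|split; [|split]].
  - specialize (I false false); rewrite euler_sum_ff in I.
    cbn [sgn zeta_sgn Rval_sgn xorb] in I; rewrite !Rmult_1_l in I; rewrite I; f_equal; f_equal.
    f_equal; apply sum_f_R0_ext; intros k; ring.
  - specialize (I true false); rewrite euler_sum_tf in I.
    cbn [sgn zeta_sgn Rval_sgn xorb] in I; rewrite !Rmult_1_l in I.
    rewrite (sum_f_R0_ext (fun k => (1 - -1 * _) * _ * _ * _)
      (fun k => (1 + (-1) ^ k) * binom (p + q - k - 2) (p - 1)
            * Rvalb (k + 1) * Rvalb (p + q - k - 1))) in I by (intros; ring).
    lra.
  - specialize (I false true); rewrite euler_sum_ft in I.
    cbn [sgn zeta_sgn Rval_sgn xorb] in I.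
    rewrite (sum_f_R0_opp (fun j => _ * _ * _ * - _) (fun j =>
          (1 + (-1) ^ j) * binom (p + q - j - 1) (q - 1)
            * zeta j * Rvalb (p + q - j))) in I by (intros; ring).
    rewrite (sum_f_R0_opp (fun j => (1 - 1 * _) * _ * _ * - _)
      (fun k => (1 - (-1) ^ k) * binom (p + q - k - 2) (p - 1)
            * Rval (k + 1) * Rvalb (p + q - k - 1))) in I by (intros; ring).
    lra.
  - specialize (I true true); rewrite euler_sum_tt in I.
    cbn [sgn zeta_sgn Rval_sgn xorb] in I.
    rewrite (sum_f_R0_opp (fun j => _ * _ * _ * - _) (fun j =>
          (1 + (-1) ^ j) * binom (p + q - j - 1) (q - 1)
            * zetab j * Rvalb (p + q - j))) in I by (intros; ring).
    rewrite (sum_f_R0_opp (fun k => (1 - -1 * _) * _ * _ * _)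
      (fun k => (1 + (-1) ^ k) * binom (p + q - k - 2) (p - 1)
            * Rvalb (k + 1) * Rval (p + q - k - 1))) in I by (intros; ring).
    lra.
Qed.
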